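(* In the $(K,M,J)$ Gaussian interference multiple access channel (MAC) system, the maximum total degrees of freedom achievable with the symbol-to-symbol alignment-based closed-form interference alignment and cancellation (IAC) solutions is $2M$, and it is achieved when $k_{\mathrm{IAC}}=2$. That is, the maximum of $$DoF=\sum_{k=1}^{K}\sum_{j=1}^{N_k} d^{[j,k]}$$ over all group sizes $(N_k)_{k=1}^K$ with $N_k\ge 1$ and $\sum_{k=1}^K N_k=J$ and all tuples of DoFs $\{d^{[j,k]} : 1\le j\le N_k,\ 1\le k\le K\}$ for which closed-form IAC solutions based on symbol-to-symbol alignment exist equals $2M$, and this value is attained by a tuple with $k_{\mathrm{IAC}}=2$.
   Context: **System.** A $(K,M,J)$ Gaussian interference MAC system has $K$ interfering multiple access channels (MACs). Receiver $k$ ($1\le k\le K$) is associated with a group of $N_k\ge 1$ users, and $\sum_{k=1}^K N_k=J\ge K$. Every receiver and every user has $M$ antennas. User $[j,k]$ (the $j$-th user of the $k$-th MAC) sends $d^{[j,k]}$ independent packets to receiver $k$, where $d^{[j,k]}$ is an integer, $0\le d^{[j,k]}\le M$. The $M\times M$ channel matrices have entries drawn independently from a continuous distribution, and there are no channel extensions. **IAC and $k_{\mathrm{IAC}}$.** Receivers decode successively in the order $1,2,\dots,K$. Packets decoded at earlier receivers are passed over a backhaul link and cancelled at later receivers, so receiver $k$ only has to deal with interference from MACs $k+1,\dots,K$. Interference needs no alignment at a receiver where at most $M$ packets remain. The index $k_{\mathrm{IAC}}$ is defined as $k-1$, where $k$ is the smallest index such that $\sum_{k'=k}^{K}\sum_{j'=1}^{N_{k'}}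 d^{[j',k']}\le M$. Alignment is thus applied only at receivers $1,\dots,k_{\mathrm{IAC}}$. **Symbol-to-symbol alignment.** At receiver $k$, a set of $M-\sum_{j=1}^{N_k} d^{[j,k]}$ of the received interference vectors from MACs $k+1,\dots,K$ is selected as a basis of the interference subspace. Each remaining interference vector from these MACs is aligned (made collinear) with exactly one of the basis vectors, and vectors from the same transmitter are not aligned with each other. **Existence of closed-form solutions.** For the purposes of this statement, ''closed-form IAC solutions based on symbol-to-symbol alignment exist'' for the tuple $\{d^{[j,k]}\}$ means that the following known necessary and sufficient conditions hold, where $k_{\mathrm{IAC}}=k_0-1$ with $k_0$ the smallest index such that $\sum_{k'=k_0}^{K}\sum_{j'=1}^{N_{k'}} d^{[j',k']}\le M$, and $k_{\mathrm{IAC}}\in\{1,2,\dots,K-1\}$: 1. For every $k\in\{1,\dots,K-1\}$, $$\sum_{j=1}^{N_k} d^{[j,k]}+\max\{d^{[j',k']} : k+1\le k'\le K,\ 1\le j'\le N_{k'}\}\le M.$$ 2. $$\sum_{k'=k_{\mathrm{IAC}}+1}^{K}\sum_{j'=1}^{N_{k'}} d^{[j',k']}\le M.$$ 3. $$\sum_{j=1}^{N_1} d^{[j,1]}+\sum_{k=1}^{k_{\mathrm{IAC}}}(k-1)\sum_{j=1}^{N_k} d^{[j,k]}+\sum_{k'=k_{\mathrm{IAC}}+1}^{K}(k_{\mathrm{IAC}}-1)\sum_{j'=1}^{N_{k'}} d^{[j',k']}\le k_{\mathrm{IAC}}\cdot M.$$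
   Formalization: The bound DoF ≤ 2M is stated for all systems, but that 2M is attained (with k_IAC = 2) is claimed only for K ≥ 3, M ≥ 2, J ≥ 4, with M even if J = 4; for all other parameters 2M is not attained (e.g. K = 2 forces k_IAC = 1, and total 2M would violate condition 1). *)

(* Defs.v *)
From mathcomp Require Import all_boot.

Set Implicit Arguments.
Unset Strict Implicit.
Unset Printing Implicit Defensive.

(* Indices are one-based: MACs are k = 1..K, the users of MAC k are
   j = 1..N k, and d j k is d^{[j,k]}. The families N and d are total
   functions whose values outside these ranges are never used. *)

Definition group_sizes (K J : nat) (N : nat -> nat) : Prop :=
  (forall k, 1 <= k <= K -> 1 <= N k) /\ \sum_(1 <= k < K.+1) N k = J.

Definition dof_tuple (K M : nat) (N : nat -> nat) (d : nat -> nat -> nat) : Prop :=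
  forall j k, 1 <= k <= K -> 1 <= j <= N k -> d j k <= M.

Definition mac_dof (N : nat -> nat) (d : nat -> nat -> nat) (k : nat) : nat :=
  \sum_(1 <= j < (N k).+1) d j k.

Definition tail_dof (K : nat) (N : nat -> nat) (d : nat -> nat -> nat) (k : nat) : nat :=
  \sum_(k <= k' < K.+1) mac_dof N d k'.

Definition total_dof (K : nat) (N : nat -> nat) (d : nat -> nat -> nat) : nat :=
  \sum_(1 <= k < K.+1) mac_dof N d k.

Lemma exists_no_alignment_index (K M : nat) (N : nat -> nat) (d : nat -> nat -> nat) :
  exists k, (0 < k) && (tail_dof K N d k <= M).
Proof. by exists K.+1; rewrite /tail_dof big_geq. Qed.

(* The minimum may be K.+1, where the tail is empty; kIAC is then K, which
   closed_form_IAC excludes. *)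
Definition kIAC (K M : nat) (N : nat -> nat) (d : nat -> nat -> nat) : nat :=
  ex_minn (exists_no_alignment_index K M N d) - 1.

Definition closed_form_IAC (K M : nat) (N : nat -> nat) (d : nat -> nat -> nat) : Prop :=
  let kI := kIAC K M N d in
  [/\ 1 <= kI <= K - 1,
      forall k, 1 <= k <= K - 1 ->
        mac_dof N d k
          + \max_(k.+1 <= k' < K.+1) \max_(1 <= j' < (N k').+1) d j' k' <= M,
      \sum_(kI.+1 <= k' < K.+1) mac_dof N d k' <= M
    & mac_dof N d 1
        + \sum_(1 <= k < kI.+1) (k - 1) * mac_dof N d k
        + \sum_(kI.+1 <= k' < K.+1) (kI - 1) * mac_dof N d k' <= kI * M].

Definition achievable_dof (K M J n : nat) : Prop :=
  exists N d, [/\ group_sizes K J N, dof_tuple K M N d,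
                  closed_form_IAC K M N d & total_dof K N d = n].

Definition is_maximum (A : nat -> Prop) (m : nat) : Prop :=
  A m /\ forall n, A n -> n <= m.

(* Main.v *)
Require Import Defs.
From mathcomp Require Import all_boot.
From mathcomp Require Import zify.

(** With [T k] the total DoF of MACs [k..K], Abel summation turns the left-hand
    side of condition 3 into [a_1 + T 2 + ... + T kIAC], where [a_1] is the DoF
    of the first MAC.  Since [a_1 + T 2] is the total DoF and [T 3], ...,
    [T kIAC] all exceed [M], the bound [kIAC * M] leaves at most [2 * M] for the
    total (for [kIAC = 1] the total is [a_1 + T 2 <= M + M]).

    For equality, number the users linearly, all surplus users being in the last
    MAC, and with [m = M./2], [e = odd M] give them [m, m + e, m, m, e, 0, ...]
    packets. *)

Section UpperBound.

Variables (K M : nat) (N : nat -> nat) (d : nat -> nat -> nat).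

Local Notation a := (mac_dof N d).
Local Notation T := (tail_dof K N d).

(** The left-hand side of condition 3 with a free [n] in place of [kIAC], which makes induction on
    [n] possible. *)
Definition alignment_load (n : nat) : nat :=
  a 1 + \sum_(1 <= k < n.+1) (k - 1) * a k + (n - 1) * T n.+1.

Lemma tail_dof_recl k : k <= K -> T k = a k + T k.+1.
Proof. by move=> lekK; rewrite /tail_dof big_ltn. Qed.

(** The new summand [n * a n.+1] and the new tail term [n * T n.+2] merge into [n * T n.+1], one
    copy of [T n.+1] more than before. *)
Lemma alignment_loadS n :
  0 < n < K -> alignment_load n.+1 = alignment_load n + T n.+1.
Proof.
case/andP=> n_gt0 ltnK; rewrite /alignment_load big_nat_recr //=.
rewrite (tail_dof_recl n.+1) //; move: (bigop _ _ _) => S; nia.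
Qed.

Lemma tail_dof_gt k : 1 <= k <= kIAC K M N d -> M < T k.
Proof.
case/andP=> k_gt0; rewrite /kIAC; case: ex_minnP => k0 _ min_k0 lekk0.
rewrite ltnNge; apply/negP => leTM.
by have := min_k0 k; rewrite k_gt0 leTM => /(_ isT); lia.
Qed.

(** At [t = 0] the load is [a 1 + a 2 + T 3], the total itself; each further step adds some
    [T k > M], hence at least [M.+1]. *)
Lemma alignment_load_ge t : t.+2 <= kIAC K M N d -> t.+2 <= K ->
  total_dof K N d + t * M.+1 <= alignment_load t.+2.
Proof.
elim: t => [|t IHt] let2 letK.
  rewrite -[total_dof K N d]/(T 1) 2?tail_dof_recl //; last exact: ltnW.
  by rewrite /alignment_load big_nat_recr //= big_nat1; lia.
rewrite alignment_loadS //.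
have := IHt (ltnW let2) (ltnW letK).
have := @tail_dof_gt t.+3 let2; lia.
Qed.

Lemma total_dof_le : 0 < K -> closed_form_IAC K M N d -> total_dof K N d <= 2 * M.
Proof.
move=> K_gt0 []; set kI := kIAC K M N d => /andP[kI_gt0 kI_leK] _ leTM.
rewrite -big_distrr /= => load_le.
have {load_le}: alignment_load kI <= kI * M by [].
case: (ltnP 1 kI) => [kI_gt1|kI_le1].
  have [t def_kI] : exists t, kI = t.+2 by exists (kI - 2); lia.
  have := @alignment_load_ge t; rewrite -/kI def_kI => /(_ (leqnn _)).
  (* Condition 3 caps the load by [t.+2 * M], so the total is at most [2 * M - t]. *)
  nia.
have kI1 : kI = 1 by lia.
rewrite -[total_dof K N d]/(T 1) tail_dof_recl //.
move: leTM; rewrite kI1 -/(T 2) /alignment_load big_nat1; lia.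
Qed.

End UpperBound.

Section Attainment.

Variables (K M J : nat).

(** Users are numbered from 1, so entry 0 is a dummy; past the list [nth] returns 0. *)
Definition packets (p : nat) : nat :=
  nth 0 [:: 0; M./2; M./2 + odd M; M./2; M./2; nat_of_bool (odd M)] p.

Definition surplus_last (k : nat) : nat := if k < K then 1 else J - K + 1.

(** Each MAC before [K] has one user, so user [[j,k]] has number [k + j - 1]. *)
Definition linear_dof (j k : nat) : nat := packets (k + j - 1).

Local Notation N := surplus_last.
Local Notation d := linear_dof.

Lemma group_sizes_surplus_last : 0 < K <= J -> group_sizes K J N.
Proof.
case/andP=> K_gt0 leKJ.
split=> [k _|]; first by rewrite /surplus_last; case: ifP => // _; lia.
rewrite big_nat_recr //= (eq_big_nat _ _ (F2 := fun=> 1)); last first.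
  by move=> k /andP[_ ltkK]; rewrite /surplus_last ltkK.
by rewrite sum_nat_const_nat /surplus_last ltnn; lia.
Qed.

Lemma packets_le p : packets p <= M./2 + odd M.
Proof. by rewrite /packets; do 6?[case: p => [|p] /=]; rewrite ?nth_nil; lia. Qed.

(** Entry 5 is settled by [odd M <= 1 <= M./2]. *)
Lemma packets_le_half p : 2 <= M -> 2 < p -> packets p <= M./2.
Proof.
move=> M_ge2; have := leq_b1 (odd M); have : 0 < M./2 by lia.
by rewrite /packets; do 6?[case: p => [|p] //=]; rewrite ?nth_nil //; lia.
Qed.

Lemma mac_dof_linear k : k < K -> mac_dof N d k = packets k.
Proof.
by move=> ltkK; rewrite /mac_dof /surplus_last ltkK big_nat1 /linear_dof addnK.
Qed.

Lemma mac_dof_last : K <= J -> mac_dof N d K = \sum_(K <= p < J.+1) packets p.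
Proof.
move=> leKJ; rewrite /mac_dof /surplus_last ltnn big_add1 /= -[in RHS](add0n K) big_addn.
have -> : J.+1 - K = J - K + 1 by lia.
by apply: eq_bigr => j _; rewrite /linear_dof; congr packets; lia.
Qed.

Lemma tail_dof_linear k : k <= K <= J ->
  tail_dof K N d k = \sum_(k <= p < J.+1) packets p.
Proof.
case/andP=> lekK leKJ; rewrite /tail_dof big_nat_recr //= mac_dof_last //.
rewrite (@big_cat_nat _ _ _ K k J.+1) //=; last exact: leqW.
congr (_ + _); apply: eq_big_nat => i /andP[_ ltiK]; exact: mac_dof_linear.
Qed.

Lemma dof_tuple_linear : dof_tuple K M N d.
Proof.
by move=> j k _ _; apply: leq_trans (packets_le _) _; lia.
Qed.

Hypotheses (K_ge3 : 3 <= K) (M_ge2 : 2 <= M) (J_ge4 : 4 <= J) (leKJ : K <= J).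
Hypothesis even_M : J = 4 -> ~~ odd M.

(** Users 3, 4 and 5 carry [m + m + e = M] packets; if there is no user 5, then [e = 0] by
    [even_M]. *)
Lemma tail_dof3 : tail_dof K N d 3 = M.
Proof.
rewrite tail_dof_linear ?K_ge3 // big_ltn 1?big_ltn //; try lia.
have -> : \sum_(5 <= p < J.+1) packets p = odd M.
  case: (ltnP 4 J) => [J_gt4|J_le4].
    rewrite big_ltn // big_nat_cond big1 ?addn0 // => p /andP[/andP[p_ge6 _] _].
    by rewrite /packets nth_default.
  by rewrite big_geq //; have := even_M; lia.
by rewrite /packets /=; lia.
Qed.

Lemma tail_dof2 : tail_dof K N d 2 = M./2 + odd M + M.
Proof. by rewrite tail_dof_recl ?mac_dof_linear ?tail_dof3 //; lia. Qed.

Lemma total_dof_linear : total_dof K N d = 2 * M.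
Proof.
rewrite -[total_dof K N d]/(tail_dof K N d 1) tail_dof_recl; last by lia.
by rewrite mac_dof_linear ?tail_dof2 /packets /=; lia.
Qed.

(** The tail from MAC 3 just fits, while the tail from MAC 2 exceeds [M] by [m + e > 0]. *)
Lemma kIAC_linear : kIAC K M N d = 2.
Proof.
rewrite /kIAC; case: ex_minnP => k0 /andP[k0_gt0 leTM] min_k0.
have lek03 : k0 <= 3 by apply: min_k0; rewrite tail_dof3 leqnn.
have := total_dof_linear; rewrite -[total_dof K N d]/(tail_dof K N d 1) => T1.
have T2 := tail_dof2.
case: k0 k0_gt0 leTM lek03 {min_k0} => [|[|[|[|k0]]]] //= _; lia.
Qed.

Lemma closed_form_IAC_linear : closed_form_IAC K M N d.
Proof.
rewrite /closed_form_IAC kIAC_linear; split.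
- by lia.
- move=> k /andP[k_gt0 lekK]; rewrite mac_dof_linear; last by lia.
  (* Interferers of MAC [k] have numbers above [k], so only MAC 1 faces user 2 with its [m + e]
     packets. *)
  pose b := if k == 1 then M./2 + odd M else M./2.
  have packets_gt p : k < p -> packets p <= b.
    rewrite /b; case: eqP => [_ _|k_neq1 ltkp]; first exact: packets_le.
    by apply: packets_le_half; lia.
  have le_b : \max_(k.+1 <= k' < K.+1) \max_(1 <= j' < (N k').+1) d j' k' <= b.
    apply/bigmax_leqP_seq => k'; rewrite mem_index_iota => /andP[ltkk' _] _.
    apply/bigmax_leqP_seq => j'; rewrite mem_index_iota => /andP[j'_gt0 _] _.
    by apply: packets_gt; lia.
  apply: leq_trans (leq_add (leqnn _) le_b) _; rewrite /b.
  (* The sums are [m + (m + e)] for [k = 1], [(m + e) + m] for [k = 2], and at most [m + m]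
     beyond. *)
  case: eqP => [->|k_neq1]; first by rewrite /packets /=; lia.
  case: (ltnP 2 k) => [/(packets_le_half _ M_ge2)|lek2]; first by lia.
  by have -> : k = 2; rewrite /packets /=; lia.
- by rewrite -/(tail_dof K N d 3) tail_dof3.
(* Condition 3 is tight: [m + (m + e) + M = 2 * M]. *)
- rewrite -big_distrr /= -/(tail_dof K N d 3) tail_dof3 big_nat_recr //= big_nat1.
  by rewrite !mac_dof_linear /packets /=; lia.
Qed.

End Attainment.

(* The bound 2M holds for every system; equality can be reached only for the
   parameters listed before the second conclusion. *)
Theorem theorem2 (K M J : nat) (K_gt0 : 0 < K) (M_gt0 : 0 < M) (leKJ : K <= J) :
  (forall n, achievable_dof K M J n -> n <= 2 * M) /\
  (3 <= K -> 2 <= M -> 4 <= J -> (J = 4 -> ~~ odd M) ->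
   is_maximum (achievable_dof K M J) (2 * M) /\
   exists N d, [/\ group_sizes K J N, dof_tuple K M N d,
                   closed_form_IAC K M N d,
                   kIAC K M N d = 2 & total_dof K N d = 2 * M]).
Proof.
have upper n : achievable_dof K M J n -> n <= 2 * M.
  by case=> N [d [_ _ closedNd <-]]; apply: total_dof_le.
split=> // K_ge3 M_ge2 J_ge4 even_M.
have sizes : group_sizes K J (surplus_last K J).
  by apply: group_sizes_surplus_last; rewrite K_gt0.
have tuple : dof_tuple K M (surplus_last K J) (linear_dof M).
  exact: dof_tuple_linear.
have closed : closed_form_IAC K M (surplus_last K J) (linear_dof M).
  exact: closed_form_IAC_linear.
have total : total_dof K (surplus_last K J) (linear_dof M) = 2 * M.
  exact: total_dof_linear.
have kI2 : kIAC K M (surplus_last K J) (linear_dof M) = 2 by exact: kIAC_linear.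
split; last by exists (surplus_last K J), (linear_dof M).
by split=> //; exists (surplus_last K J), (linear_dof M).
Qed.
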